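(* Let $A=\bigoplus_{i\ge 0}A_i$ be a finitely generated, commutative graded algebra over $A_0$, and let $h\ge 1$ be the maximum degree of a minimal algebra generator of $A$. Let $d_h=\operatorname{lcm}(1,\ldots,h)$. Then the $d_h$-th Veronese subalgebra $A^{(d_h)}$ is standard graded. In particular, $\operatorname{svd}(A)\le \operatorname{lcm}(1,\ldots,h)$.
   Context: The maximum degree of a minimal algebra generator of $A$ is the largest degree of an element in an inclusion-minimal finite set of homogeneous elements of positive degree generating $A$ as an $A_0$-algebra; in particular $A$ is generated over $A_0$ by $A_1,\dots,A_h$. For an integer $c\ge 1$, the $c$-th Veronese subalgebra is $A^{(c)}=\bigoplus_{i\ge 0}A_{ic}$, regarded as a graded $A_0$-algebra with $A_{ic}$ in degree $i$. A graded algebra over its degree-zero part is standard graded if it is generated as an algebra by its degree-one component; thus $A^{(c)}$ is standard graded if and only if $A_{ck}=(A_c)^k$ for all $k\ge 1$, where $(A_c)^k$ is the $A_0$-submodule generated by the $k$-fold products of elements of $A_c$. The standard Veronese degree $\operatorname{svd}(A)$ is the least integer $c\ge 1$ such that $A^{(c)}$ is standard graded. *)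

(* Defs.v *)
From HB Require Import structures.
From mathcomp Require Import all_boot all_order all_algebra.
From mathcomp Require Import all_classical.

Set Implicit Arguments.
Unset Strict Implicit.
Unset Printing Implicit Defensive.

Import GRing.Theory.
Local Open Scope classical_set_scope.
Local Open Scope ring_scope.

(* A graded algebra is given internally, by the family of its homogeneous     *)
(* components inside an ambient commutative ring R. Its underlying ring is    *)
(* [gr_total G], which may be smaller than R, so that a graded ring and its   *)
(* Veronese subalgebras are objects of the same kind.                         *)

Section GradedAlgebra.

Variable R : comPzRingType.
Implicit Types (G : nat -> set R) (S : set R).

Definition gr_total G : set R :=
  [set a | exists n (f : nat -> R),
     (forall i, G i (f i)) /\ a = \sum_(i < n) f i].

Record graded_algebra G : Prop := GradedAlgebra {
  gr_zmod : forall i, zmod_closed [in G i];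
  gr_one : G 0%N 1;
  gr_mul : forall i j x y, G i x -> G j y -> G (i + j)%N (x * y);
  gr_direct : forall n (f : nat -> R), (forall i, G i (f i)) ->
    \sum_(i < n) f i = 0 -> forall i, (i < n)%N -> f i = 0
}.

(* the K-subalgebra K[S] of R, for a subring K *)
Definition adjoin (K S : set R) : set R :=
  smallest (fun B : set R => subring_closed [in B]) (K `|` S).

Definition generates G S : Prop := adjoin (G 0%N) S = gr_total G.

Definition fin_gen_algebra G : Prop :=
  exists2 S : set R, finite_set S & generates G S.

Definition homogeneous_generators G S : Prop :=
  [/\ finite_set S,
      (forall s, S s -> exists2 i, (0 < i)%N & G i s) &
      generates G S].

Definition minimal_generators G S : Prop :=
  homogeneous_generators G S /\
  (forall T, homogeneous_generators G T -> T `<=` S -> T = S).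

(* 0 lies in every component, but it never belongs to a minimal S, so that    *)
(* each s in S has exactly one degree. The degrees occurring in S are those   *)
(* where A_+ / (A_+)^2 is nonzero: h does not depend on S.                    *)
Definition max_generator_degree G (h : nat) : Prop :=
  exists S, [/\ minimal_generators G S,
    (exists2 s, S s & G h s) &
    (forall s i, S s -> G i s -> (i <= h)%N)].

Definition veronese G (c : nat) : nat -> set R := fun i => G (i * c)%N.

Definition standard_graded G : Prop := generates G (G 1%N).

(* A relation, as no c need exist for an arbitrary G. *)
Definition is_svd G (c : nat) : Prop :=
  [/\ (0 < c)%N, standard_graded (veronese G c) &
      (forall c', (0 < c')%N -> standard_graded (veronese G c') ->
        (c <= c')%N)].

Lemma veronese_graded G c : (0 < c)%N ->
  graded_algebra G -> graded_algebra (veronese G c).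
Proof.
move=> c0 [Gz G1 Gm Gd]; split; rewrite /veronese.
- by move=> i; exact: Gz.
- by rewrite mul0n.
- by move=> i j x y; rewrite mulnDl; exact: Gm.
- move=> n f Gf sf0 i ltin.
  pose g j := if (c %| j)%N then f (j %/ c)%N else 0.
  have Gg j : G j (g j).
    rewrite /g; case: ifP => [cj|_]; last first.
      by have [] := Gz j; rewrite inE.
    by rewrite -{1}(divnK cj); exact: Gf.
  have sg : \sum_(j < n * c) g j = \sum_(i < n) f i.
    elim: {sf0 i ltin} n => [|n IHn]; first by rewrite mul0n !big_ord0.
    rewrite big_ord_recr /= -IHn mulSn addnC big_split_ord /=; congr (_ + _).
    case: c c0 {Gf Gg IHn} @g => // c _ g.
    rewrite big_ord_recl /= big1 => [|k _].
      by rewrite addr0 addn0 /g dvdn_mull // mulnK.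
    rewrite /g dvdn_addr ?dvdn_mull // gtnNdvd //=.
    by rewrite /bump /= add1n ltnS.
  have := Gd _ _ Gg (etrans sg sf0) (i * c)%N.
  by rewrite ltn_pmul2r // /g dvdn_mull // mulnK // => ->.
Qed.

End GradedAlgebra.

Definition lcm_upto (h : nat) : nat := \big[lcmn/1%N]_(1 <= i < h.+1) i.

(* Main.v *)
(* A_n is spanned over A_0 by the monomials of degree n in homogeneous        *)
(* elements of degrees 1, ..., h, so with d = lcm(1, ..., h) it suffices that *)
(* a multiset of integers in [1, h] whose sum is kd, k >= 1, has a            *)
(* sub-multiset of sum d. For k >= 2, some a occurs at least h - 1 times:     *)
(* otherwise the sum is at most (h - 2)h(h + 1)/2, which is less than 2d, as  *)
(* 2d >= h(h - 1)(h - 2) if h >= 4 and by inspection if h <= 3. By the        *)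
(* pigeonhole principle on prefix sums, the other terms split into blocks of  *)
(* at most a terms with sum divisible by a. Add blocks greedily while the sum *)
(* stays at most d; the gap left is a multiple of a, and it is at most        *)
(* a(h - 1) or all blocks have been used, so copies of a fill it.             *)
Require Import Defs.
From HB Require Import structures.
From mathcomp Require Import all_boot all_order all_algebra.
From mathcomp Require Import all_classical.
From mathcomp Require Import zify.

Set Implicit Arguments.
Unset Strict Implicit.
Unset Printing Implicit Defensive.

Local Open Scope classical_set_scope.
Local Open Scope ring_scope.

(** With d = lcm(1, ..., h), [homogeneous_monomial_span] writes an element of degree kd as a sum of
    monomials with factors of degrees in [1, h]. Among the degrees of such a monomial,
    [subset_sum_lcm_upto] finds a sub-multiset of sum d; the corresponding factors multiply to an
    element of A_d, and induction on k in [monomial_adjoin] puts the monomial into the subalgebra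
    generated by A_d. The subset sum exists because [frequent_term] provides a value a repeated at
    least h - 1 times, whose copies correct a greedy choice of blocks in
    [subset_sum_of_frequent]. *)

(** * Subset sums equal to lcm(1, ..., h) *)

Section SubsetSums.
Local Open Scope nat_scope.
Implicit Types (s t u b : seq nat) (a d h i k m n : nat).

Lemma zero_sum_infix a s : 0 < a -> a <= size s ->
  exists t1 t2 t3, [/\ s = t1 ++ t2 ++ t3, 0 < size t2 <= a & a %| sumn t2].
Proof.
move=> a0 las.
(* The prefixes of lengths 0, ..., a have a + 1 sums but only a residues. *)
pose f (i : 'I_a.+1) : 'I_a := Ordinal (ltn_pmod (sumn (take i s)) a0).
have /injectivePn [i [j nij fij]] : ~~ injectiveb f.
  by apply/negP => /injectiveP /leq_card; rewrite !card_ord ltnn.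
wlog ltij : i j nij fij / i < j.
  move=> W; case: (ltngtP i j) => ij; first exact: (W i j).
    by apply: (W j i) => //; rewrite eq_sym.
  by rewrite (val_inj ij) eqxx in nij.
have ja : j <= a by rewrite -ltnS.
have Ej : take j s = take i s ++ take (j - i) (drop i s).
  rewrite take_drop subnK 1?ltnW // -{1}(cat_take_drop i (take j s)).
  by rewrite take_takel // ltnW.
exists (take i s), (take (j - i) (drop i s)), (drop j s); split.
- by rewrite catA -Ej cat_take_drop.
- by rewrite size_take size_drop; case: ifP; lia.
- move/(congr1 val): fij => /= /eqP.
  by rewrite eq_sym Ej sumn_cat eqn_mod_dvd ?leq_addr // addKn.
Qed.

(** Infixes of sum divisible by a are split off while more than a terms remain; what is left is
    itself a block, since the total is divisible by a. *)
Lemma zero_sum_blocks a s : 0 < a -> a %| sumn s ->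
  exists2 ss, perm_eq s (flatten ss) &
    {in ss, forall b, size b <= a /\ a %| sumn b}.
Proof.
move=> a0; have [n] := ubnP (size s); elim: n s => // n IHn s ltsn das.
have [lesa|ltas] := leqP (size s) a.
  exists [:: s] => [|b]; first by rewrite /= cats0.
  by rewrite inE => /eqP ->.
have [t1 [t2 [t3 [Es /andP[t2pos t2a] dt2]]]] := zero_sum_infix a0 (ltnW ltas).
have ps : perm_eq s (t2 ++ t1 ++ t3) by rewrite Es perm_catCA.
have [||ss pss Hss] := IHn (t1 ++ t3).
- by move: ltsn; rewrite Es !size_cat; lia.
- by move: das; rewrite (perm_sumn ps) sumn_cat dvdn_addr.
exists (t2 :: ss) => [|b]; first by rewrite (perm_trans ps) //= perm_cat2l.
by rewrite inE => /orP[/eqP ->|/Hss].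
Qed.

(** Here d is the part of the target still to be reached. At the first block that does not fit, d is
    a multiple of a below a * h, so at most h - 1 copies of a close the gap; if every block fits,
    the bound on d leaves enough copies. *)
Lemma greedy_blocks a h n d (ss : seq (seq nat)) :
    0 < a -> a %| d -> h.-1 <= n -> d <= sumn (flatten ss) + a * n ->
    {in ss, forall b, a %| sumn b /\ sumn b <= a * h} ->
  exists t u m, [/\ perm_eq (flatten ss) (t ++ u), m <= n & sumn t + a * m = d].
Proof.
move=> a0 + hn; elim: ss d => [|b ss IHss] d /dvdnP[m ->] ledn Hss.
  exists [::], [::], m; split=> //; last by rewrite add0n mulnC.
  by move: ledn; rewrite /= add0n mulnC leq_pmul2l.
have [db leb] := Hss b (mem_head _ _).
have [lebd|ltdb] := leqP (sumn b) (m * a).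
  have [|||t [u [q [ptu qn Eq]]]] := IHss (m * a - sumn b).
  - by rewrite dvdn_sub ?dvdn_mull.
  - by move: ledn; rewrite /= sumn_cat; lia.
  - by move=> c css; apply: Hss; rewrite inE css orbT.
  exists (b ++ t), u, q; split=> //; last by rewrite sumn_cat; lia.
  by rewrite -catA perm_cat2l.
exists [::], (flatten (b :: ss)), m; split=> //; last by rewrite add0n mulnC.
have : m < h by rewrite -(ltn_pmul2l a0) mulnC (leq_trans ltdb).
lia.
Qed.

Lemma sumn_le_mul s h : {in s, forall i, i <= h} -> sumn s <= size s * h.
Proof.
elim: s => //= i s IHs Hs.
rewrite mulSn leq_add ?Hs ?mem_head // IHs // => j js.
by rewrite Hs // inE js orbT.
Qed.

Lemma perm_nseq_filter a s :
  perm_eq s (nseq (count_mem a s) a ++ [seq i <- s | i != a]).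
Proof.
have <- : seq.filter (pred1 a) s = nseq (count_mem a s) a.
  by rewrite -size_filter; apply/all_pred1P; exact: filter_all.
by rewrite perm_sym; apply/permPl/(perm_filterC (pred1 a)).
Qed.

(** The sum is at most m(1 + ... + h); doubling avoids a division. *)
Lemma sumn_le_count s h m : {in s, forall i, i <= h} ->
  (forall i, 0 < i <= h -> count_mem i s <= m) -> 2 * sumn s <= m * (h * h.+1).
Proof.
elim: h s => [|h IHh] s Hs Hm.
  by have := sumn_le_mul Hs; rewrite muln0; lia.
have ps := perm_nseq_filter h.+1 s.
rewrite (perm_sumn ps) sumn_cat sumn_nseq.
have : 2 * sumn ([seq i <- s | i != h.+1]) <= m * (h * h.+1).
  apply: IHh => [i|i /andP[i0 ih]].
    by rewrite mem_filter /= => /andP[nih /Hs]; lia.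
  apply: leq_trans (Hm i _); last by lia.
  by rewrite count_filter; apply: sub_count => j /= /andP[].
have := Hm h.+1 (leqnn _); set c := count_mem _ _; nia.
Qed.

Lemma subset_sum_of_frequent s a h d :
    {in s, forall i, i <= h} -> 0 < a <= h -> a %| d -> a %| sumn s ->
    d <= sumn s -> h.-1 <= count_mem a s ->
  exists t u, perm_eq s (t ++ u) /\ sumn t = d.
Proof.
move=> Hs /andP[a0 ah] ad das ds ha; set n := count_mem a s in ha.
pose r := [seq i <- s | i != a].
have ps : perm_eq s (nseq n a ++ r) := perm_nseq_filter a s.
have Es : sumn s = a * n + sumn r.
  by rewrite (perm_sumn ps) sumn_cat sumn_nseq.
have ar : a %| sumn r by move: das; rewrite Es dvdn_addr ?dvdn_mulr.
have [ss pss Hss] := zero_sum_blocks a0 ar.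
have [||t [u [m [ptu mn Em]]]] := @greedy_blocks a h n d ss a0 ad ha.
- by rewrite -(perm_sumn pss); lia.
(* A block has at most a terms, each at most h. *)
- move=> b bss; have [sb db] := Hss b bss; split=> //.
  apply: leq_trans (_ : size b * h <= _); last by rewrite leq_mul2r sb orbT.
  apply: sumn_le_mul => i ib; apply: Hs.
  have : i \in r by rewrite (perm_mem pss); apply/flattenP; exists b.
  by rewrite mem_filter => /andP[].
exists (nseq m a ++ t), (nseq (n - m) a ++ u); split.
  rewrite (perm_trans ps) // -[in nseq n a](subnKC mn) nseqD -!catA perm_cat2l.
  by rewrite perm_sym perm_catCA perm_cat2l perm_sym (perm_trans pss).
by rewrite sumn_cat sumn_nseq addnC.
Qed.

Lemma lcm_uptoS h : lcm_upto h.+1 = lcmn (lcm_upto h) h.+1.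
Proof. by rewrite /lcm_upto big_nat_recr. Qed.

Lemma lcm_upto_gt0 h : 0 < lcm_upto h.
Proof.
elim: h => [|h IHh]; first by rewrite /lcm_upto big_geq.
by rewrite lcm_uptoS lcmn_gt0 IHh.
Qed.

Lemma dvdn_lcm_upto i h : 0 < i <= h -> i %| lcm_upto h.
Proof.
move=> /andP[i0]; elim: h => [|h IHh]; first by lia.
rewrite lcm_uptoS leq_eqVlt => /orP[/eqP ->|]; first exact: dvdn_lcmr.
by rewrite ltnS => /IHh ih; apply: dvdn_trans ih (dvdn_lcml _ _).
Qed.

(** m + 1 is coprime to m and to m + 2, while m(m + 2) is lcm(m, m + 2) times gcd(m, m + 2), and
    this gcd divides 2. *)
Lemma dvdn_double_lcm_upto m : 0 < m ->
  m * m.+2 * m.+1 %| 2 * lcm_upto m.+2.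
Proof.
move=> m0; set D := lcm_upto _.
rewrite Gauss_dvd; last first.
  by rewrite coprimeMl coprimenS coprime_sym coprimenS.
apply/andP; split; last by apply/dvdn_mull/dvdn_lcm_upto; lia.
rewrite -muln_lcm_gcd mulnC dvdn_mul //.
  by rewrite -addn2 gcdnDl dvdn_gcdr.
by rewrite dvdn_lcm !dvdn_lcm_upto //; lia.
Qed.

Lemma frequent_term s h : 0 < h -> {in s, forall i, i <= h} ->
  2 * lcm_upto h <= sumn s -> exists2 a, 0 < a <= h & h.-1 <= count_mem a s.
Proof.
move=> h0 Hs; case: h h0 Hs => [|[|h]] // _ Hs ds; first by exists 1.
apply: contrapT => nex.
have : 2 * sumn s <= h * (h.+2 * h.+3).
  apply: sumn_le_count => // i ih; rewrite leqNgt; apply/negP => hi.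
  by apply: nex; exists i.
have D0 := lcm_upto_gt0 h.+2.
(* The original bound is now [h.+2]. Its values 2 and 3 are checked directly; beyond them, with m
   the bound minus 2, the estimate m(m + 1)(m + 2) <= 2 lcm contradicts the count because 2(m + 1) >
   m + 3 for m > 1. *)
case: h Hs ds {nex} D0 => [|[|h]] Hs ds D0; first by lia.
  by move: ds; have -> : lcm_upto 3 = 6 by [rewrite /lcm_upto unlock]; lia.
have := dvdn_leq _ (@dvdn_double_lcm_upto h.+2 isT).
rewrite muln_gt0 D0 => /(_ isT); nia.
Qed.

Lemma subset_sum_lcm_upto s h k : 0 < h -> {in s, forall i, i <= h} ->
  sumn s = k.+1 * lcm_upto h ->
  exists t u, [/\ perm_eq s (t ++ u), sumn t = lcm_upto h
                & sumn u = k * lcm_upto h].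
Proof.
move=> h0 Hs; case: k => [|k] Es.
  by exists s, [::]; rewrite cats0 Es mul1n.
have ds : 2 * lcm_upto h <= sumn s by rewrite Es leq_mul2r orbT.
have [a ah Ha] := frequent_term h0 Hs ds.
have ad := dvdn_lcm_upto ah.
have das : a %| sumn s by rewrite Es dvdn_mull.
have dles : lcm_upto h <= sumn s by rewrite Es leq_pmull.
have [t [u [ptu Et]]] := subset_sum_of_frequent Hs ah ad das dles Ha.
exists t, u; split=> //.
by move: Es; rewrite (perm_sumn ptu) sumn_cat Et mulSn => /addnI.
Qed.

End SubsetSums.

Import GRing.Theory.

(** * Closure properties of [gr_total] and [adjoin] *)

Lemma zmod_closed_add (R : zmodType) (S : set R) :
  zmod_closed [in S] -> forall x y, S x -> S y -> S (x + y).
Proof.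
move=> [S0 SB] x y Sx Sy; have := SB x (0 - y); rewrite !inE sub0r opprK.
by apply=> //; have := SB 0 y; rewrite !inE sub0r; apply=> //; rewrite -inE.
Qed.

Section GradedTotal.
Variables (R : comPzRingType) (G : nat -> set R).
Hypothesis Gzmod : forall i, zmod_closed [in G i].

Let G0 i : G i 0. Proof. by have [] := Gzmod i; rewrite inE. Qed.

Let GB i x y : G i x -> G i y -> G i (x - y).
Proof.
by move=> Gx Gy; have [_ /(_ x y)] := Gzmod i; rewrite !inE; apply.
Qed.

Lemma gr_total_homogeneous i x : G i x -> gr_total G x.
Proof.
move=> Gx; exists i.+1, (fun j => if j == i then x else 0); split.
  by move=> j; case: eqP => [->|_].
rewrite big_ord_recr /= eqxx big1 ?add0r // => j _.
by rewrite ltn_eqF.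
Qed.

Lemma gr_total_zmod : zmod_closed [in gr_total G].
Proof.
split=> [|x y]; first by rewrite inE; exact: gr_total_homogeneous (G0 0).
rewrite !inE => -[n [f [Gf ->]]] [m [g [Gg ->]]].
exists (maxn n m), (fun i => (if (i < n)%N then f i else 0) -
                             (if (i < m)%N then g i else 0)); split.
  by move=> i; apply: GB; case: ifP.
rewrite sumrB; congr (_ - _).
  by rewrite (big_ord_widen _ f (leq_maxl n m)) big_mkcond.
by rewrite (big_ord_widen _ g (leq_maxr n m)) big_mkcond.
Qed.

Lemma gr_total_sum (I : Type) (r : seq I) (F : I -> R) :
  (forall i, gr_total G (F i)) -> gr_total G (\sum_(i <- r) F i).
Proof.
move=> GF; apply: big_ind => //; first exact: gr_total_homogeneous (G0 0).
exact: zmod_closed_add gr_total_zmod.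
Qed.

Hypotheses (G1 : G 0%N 1)
  (GM : forall i j x y, G i x -> G j y -> G (i + j)%N (x * y)).

(** Stated for any family with these closure properties, as it serves for the spans
    [monomial_span h] as well as for graded algebras. *)
Lemma gr_total_subring : subring_closed [in gr_total G].
Proof.
split; first by rewrite inE; exact: gr_total_homogeneous G1.
  by have [] := gr_total_zmod.
move=> x y; rewrite !inE => -[n [f [Gf ->]]] [m [g [Gg ->]]].
rewrite mulr_suml; apply: gr_total_sum => i.
rewrite mulr_sumr; apply: gr_total_sum => j.
exact: gr_total_homogeneous (GM (Gf i) (Gg j)).
Qed.

End GradedTotal.

Lemma adjoin_subring (R : comPzRingType) (K S : set R) :
  subring_closed [in adjoin K S].
Proof.
split=> [|x y|x y]; rewrite !inE.
- by move=> B [[B1 _ _] _]; rewrite inE in B1.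
- move=> Kx Ky B BP; have [[_ BB _] _] := BP.
  have := BB x y; rewrite !inE; apply.
    exact: Kx BP.
  exact: Ky BP.
- move=> Kx Ky B BP; have [[_ _ BM] _] := BP.
  have := BM x y; rewrite !inE; apply.
    exact: Kx BP.
  exact: Ky BP.
Qed.

Lemma adjoin_coef (R : comPzRingType) (K S : set R) : K `<=` adjoin K S.
Proof. by move=> x Kx; apply: sub_gen_smallest; left. Qed.

Lemma adjoin_gen (R : comPzRingType) (K S : set R) : S `<=` adjoin K S.
Proof. by move=> x Sx; apply: sub_gen_smallest; right. Qed.

(** * Monomials and their spans *)

Section Monomials.
Variables (R : comPzRingType) (G : nat -> set R).
Hypothesis grG : graded_algebra G.
Implicit Types (s t : seq nat) (x y c : R).

(* The sequence lists the degrees of the factors; the innermost factor is a   *)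
(* coefficient of degree 0, not listed.                                       *)
Inductive monomial : seq nat -> set R :=
| monomial_coef c : G 0%N c -> monomial [::] c
| monomial_cons i s x y : G i x -> monomial s y -> monomial (i :: s) (x * y).

Lemma monomialN s x : monomial s x -> monomial s (- x).
Proof.
elim=> [c Gc|i {}s {}x y Gx _ IH]; last by rewrite -mulrN; constructor.
constructor; have [z0 zB] := gr_zmod grG 0.
by have := zB 0 c z0; rewrite !inE sub0r; apply.
Qed.

Lemma monomialM s t x y :
  monomial s x -> monomial t y -> monomial (s ++ t) (x * y).
Proof.
elim=> [c Gc|i {}s {}x z Gx _ IH] my; last first.
  by rewrite -mulrA; constructor => //; exact: IH.
elim: my => [e Ge|i {}t {}x {}y Gx _ IH].
  by constructor; exact: (gr_mul grG Gc Ge).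
by rewrite mulrCA; constructor.
Qed.

Lemma monomial_split s t x : monomial (s ++ t) x ->
  exists y z, [/\ monomial s y, monomial t z & x = y * z].
Proof.
elim: s x => [|i s IHs] x /= mx.
  exists 1, x; split=> //; last by rewrite mul1r.
  by constructor; exact: gr_one.
inversion mx as [|j s' u v Gu mv]; subst.
have [y [z [my mz ->]]] := IHs _ mv.
by exists (u * y), z; split=> //; [constructor|rewrite mulrA].
Qed.

(** By commutativity the order of the degrees is immaterial, so a chosen sub-multiset of factors can
    be moved to the front and split off. *)
Lemma perm_monomial s t x : perm_eq s t -> monomial s x -> monomial t x.
Proof.
elim: s t x => [|i s IHs] t x pst mx.
  by move: pst; rewrite perm_sym => /perm_nilP ->.
have /path.splitPr Et : i \in t by rewrite -(perm_mem pst) mem_head.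
case: Et pst => t1 t2; rewrite -cat_rcons => pst.
inversion mx as [|j s' u v Gu mv]; subst.
have : monomial (t1 ++ t2) v.
  apply: IHs mv; rewrite -(perm_cons i) (perm_trans pst) //.
  by rewrite cat_rcons -[i :: t2]cat1s perm_catCA.
case/monomial_split => y [z [my mz ->]].
rewrite mulrCA cat_rcons; apply: monomialM my _.
by constructor.
Qed.

Lemma monomial_homogeneous s x : monomial s x -> G (sumn s) x.
Proof. by elim=> // i {}s {}x y Gx _ IH; exact: gr_mul. Qed.

(** Finite sums built term by term, to allow induction; coefficients sit inside the monomials, so no
    scalars appear. *)
Inductive monomial_span (h n : nat) : set R :=
| span0 : monomial_span h n 0
| spanD s x y : {in s, forall i, (0 < i <= h)%N} -> sumn s = n ->
    monomial s x -> monomial_span h n y -> monomial_span h n (x + y).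

Lemma monomial_span_zmod h n : zmod_closed [in monomial_span h n].
Proof.
split=> [|x y]; rewrite !inE; first exact: span0.
elim=> [|s {}x z Hs Es mx _ IH] sy; last first.
  by rewrite -addrA; apply: spanD Hs Es mx _; exact: IH.
elim: sy => [|s {}y z Hs Es my _ IH]; first by rewrite subr0; exact: span0.
rewrite opprD addrCA; apply: spanD Hs Es _ IH; exact: monomialN.
Qed.

Lemma span_monomial h s x : {in s, forall i, (0 < i <= h)%N} ->
  monomial s x -> monomial_span h (sumn s) x.
Proof.
by move=> Hs mx; rewrite -[x]addr0; apply: spanD Hs _ mx _ => //; exact: span0.
Qed.

Lemma monomial_span_mul h n m x y :
  monomial_span h n x -> monomial_span h m y -> monomial_span h (n + m) (x * y).
Proof.
have spanDD := zmod_closed_add (monomial_span_zmod h (n + m)).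
elim=> [|s {}x x' Hs Es mx _ IH] sy; first by rewrite mul0r; exact: span0.
rewrite mulrDl; apply: (spanDD); last exact: IH.
elim: sy {IH} => [|t {}y y' Ht Et my _ IHy].
  by rewrite mulr0; exact: span0.
rewrite mulrDr; apply: (spanDD) IHy; rewrite -Es -Et -sumn_cat.
apply: span_monomial; last exact: monomialM.
by move=> i; rewrite mem_cat => /orP[/Hs|/Ht].
Qed.

Lemma monomial_span_homogeneous h n x : monomial_span h n x -> G n x.
Proof.
have Gz := gr_zmod grG n.
elim=> [|s {}x y _ Es mx _ IH]; first by have [] := Gz; rewrite inE.
by apply: zmod_closed_add Gz _ _ _ IH; rewrite -Es; exact: monomial_homogeneous.
Qed.

(* The components of G are recovered from the spans by directness, once the   *)
(* spans add up to the whole algebra.                                         *)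
Lemma homogeneous_monomial_span h S :
    generates G S -> (forall a, S a -> exists2 i, (0 < i <= h)%N & G i a) ->
  forall n x, G n x -> monomial_span h n x.
Proof.
move=> genS Sdeg n x Gx.
have spanG := @monomial_span_homogeneous h.
have spanz := monomial_span_zmod h.
(* The total of the spans is a subring containing [G 0] and S, hence contains the whole algebra. *)
have : gr_total (monomial_span h) x.
  have : gr_total G x by apply: gr_total_homogeneous Gx; exact: gr_zmod.
  rewrite -genS; apply: smallest_sub => [|y [Gy|/Sdeg[i ih Gy]]].
  - apply: gr_total_subring => //; last exact: monomial_span_mul.
    apply: (@span_monomial h [::]) => //.
    by constructor; exact: gr_one.
  - apply: (@gr_total_homogeneous _ _ spanz 0).
    by apply: (@span_monomial h [::]) => //; constructor.
  - apply: (@gr_total_homogeneous _ _ spanz i).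
    rewrite -[i]addn0 -[y]mulr1; apply: (@span_monomial h [:: i]).
      by move=> j; rewrite inE => /eqP ->.
    by do 2?constructor => //; exact: gr_one.
case=> m [f [Mf Ex]].
pose f' i := if (i < m)%N then f i else 0.
have Mf' i : monomial_span h i (f' i).
  by rewrite /f'; case: ifP => // _; exact: span0.
pose M := maxn m n.+1; have ltnM : (n < M)%N by rewrite leq_maxr.
have Ex' : x = \sum_(i < M) f' i.
  by rewrite Ex (big_ord_widen _ f (leq_maxl m n.+1)) big_mkcond.
(* The difference of two homogeneous decompositions of x: into span elements, and as x alone in
   degree n. Directness makes it vanish, so x is [f' n]. *)
pose g i := f' i - (if i == n then x else 0).
have Gg i : G i (g i).
  have [z0 zB] := gr_zmod grG i; have := zB (f' i) (if i == n then x else 0).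
  rewrite !inE; apply; first exact: spanG.
  by case: eqP => [->//|_]; rewrite -inE.
have g0 : \sum_(i < M) g i = 0.
  rewrite sumrB -Ex' (bigD1 (Ordinal ltnM)) //= eqxx big1 ?addr0 ?subrr // => i.
  by rewrite -val_eqE /= => /negPf ->.
have /eqP := gr_direct grG Gg g0 ltnM.
by rewrite /g eqxx subr_eq0 => /eqP <-.
Qed.

End Monomials.

(** * Generation of the Veronese subalgebra in degree one *)

Lemma monomial_adjoin (R : comPzRingType) (G : nat -> set R) h k s x :
    graded_algebra G -> (0 < h)%N -> {in s, forall i, (0 < i <= h)%N} ->
    sumn s = (k * lcm_upto h)%N -> monomial G s x ->
  adjoin (G 0%N) (G (lcm_upto h)) x.
Proof.
move=> grG h0; elim: k s x => [|k IHk] s x Hs Es mx.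
  have := monomial_homogeneous grG mx.
  by rewrite Es mul0n; exact: adjoin_coef.
(* The factors with degrees t give an element of A_d; the others form a monomial of degree kd. *)
have [i /Hs /andP[]//|t [u [pstu Et Eu]]] := subset_sum_lcm_upto h0 _ Es.
have [y [z [my mz ->]]] := monomial_split grG (perm_monomial grG pstu mx).
have [_ _ KM] := adjoin_subring (G 0%N) (G (lcm_upto h)).
have := KM y z; rewrite !inE; apply.
  by apply: adjoin_gen; rewrite -Et; exact: monomial_homogeneous.
apply: IHk mz => // i iu; apply: Hs.
by rewrite (perm_mem pstu) mem_cat iu orbT.
Qed.

Lemma veronese_lcm_standard (R : comPzRingType) (G : nat -> set R) S h :
    graded_algebra G -> (0 < h)%N -> generates G S ->
    (forall a, S a -> exists2 i, (0 < i <= h)%N & G i a) ->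
  standard_graded (veronese G (lcm_upto h)).
Proof.
move=> grG h0 genS Sdeg; set d := lcm_upto h.
have grV := veronese_graded (lcm_upto_gt0 h : (0 < d)%N) grG.
have V0 : veronese G d 0 = G 0%N by rewrite /veronese mul0n.
have V1 : veronese G d 1 = G d by rewrite /veronese mul1n.
rewrite /standard_graded /generates; apply/seteqP; split=> x.
  apply: smallest_sub => [|y [Vy|Vy]].
  - by apply: gr_total_subring; [exact: gr_zmod|exact: gr_one|exact: gr_mul].
  - by apply: gr_total_homogeneous Vy; exact: gr_zmod.
  - by apply: gr_total_homogeneous Vy; exact: gr_zmod.
rewrite V0 V1 => -[n [f [Vf ->]]].
have Kz : zmod_closed [in adjoin (G 0%N) (G d)].
  exact: GRing.subring_closedB (adjoin_subring _ _).
have KD := zmod_closed_add Kz.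
have K0 : adjoin (G 0%N) (G d) 0 by have [] := Kz; rewrite inE.
(* Each [f i] has degree [i * d] in G, so [monomial_adjoin] applies with k = i to its monomials. *)
apply: (big_ind (adjoin (G 0%N) (G d))) => // i _.
elim: (homogeneous_monomial_span grG genS Sdeg (Vf i)) => [//|s y z Hs Es my _].
by move=> IH; apply: KD IH; exact: monomial_adjoin grG h0 Hs Es my.
Qed.

Theorem corollary3p5 (A : comPzRingType) (A_ : nat -> set A) (h : nat)
    (grA : graded_algebra A_)
    (totA : gr_total A_ = [set: A])
    (fgA : fin_gen_algebra A_)
    (h_ge1 : (1 <= h)%N)
    (maxh : max_generator_degree A_ h) :
  standard_graded (veronese A_ (lcm_upto h)) /\
  (exists2 c, is_svd A_ c & (c <= lcm_upto h)%N).
Proof.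
have std : standard_graded (veronese A_ (lcm_upto h)).
  have [S [[[_ Spos genS] _] _ Sle]] := maxh.
  apply: veronese_lcm_standard genS _ => // s Ss.
  by have [i i0 Ai] := Spos s Ss; exists i => //; rewrite i0 (Sle s).
split=> //.
(* The least c is found by [ex_minnP], which needs a boolean predicate; lcm(1, ..., h) witnesses
   that it is satisfiable. *)
pose P c := (0 < c)%N && `[< standard_graded (veronese A_ c) >].
have exP : exists c, P c.
  by exists (lcm_upto h); rewrite /P lcm_upto_gt0; apply/asboolP.
have [c /andP[c0 /asboolP stc] minc] := ex_minnP exP; exists c.
  by split=> // c' c'0 stc'; apply: minc; rewrite /P c'0; apply/asboolP.
by apply: minc; rewrite /P lcm_upto_gt0; apply/asboolP.
Qed.
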